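(* The shortness exponent of the class of $1$-tough chordal planar graphs is $0$.
   Context: All graphs are finite and simple. The toughness of a graph $G$ is the minimum, taken over all separating sets $X$ of vertices of $G$ (sets such that $G-X$ is disconnected), of the ratio of $|X|$ to the number of components of $G-X$; the toughness of a complete graph is infinite. A graph is $t$-tough if its toughness is at least $t$. The shortness exponent of a class of graphs $\Gamma$ is the $\liminf$, taken over all infinite sequences $G_1, G_2, \dots$ of non-isomorphic graphs of $\Gamma$ (for $n$ going to infinity), of $\log_{|V(G_n)|} c(G_n) = \frac{\log c(G_n)}{\log |V(G_n)|}$, where $c(G_n)$ is the length (number of vertices) of a longest cycle in $G_n$; that is, the infimum over all such sequences of $\liminf_{n\to\infty} \log_{|V(G_n)|} c(G_n)$. *)

(* Defs.v *)
From mathcomp Require Import all_boot all_order all_algebra.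
From mathcomp Require Import all_classical all_reals all_analysis.
Import Order.TTheory GRing.Theory Num.Theory.
Import numFieldNormedType.Exports.

Set Implicit Arguments.
Unset Strict Implicit.
Unset Printing Implicit Defensive.

Local Open Scope classical_set_scope.
Local Open Scope ring_scope.

Record sgraph := SGraph {
  vertex :> finType;
  adj : rel vertex;
  adj_sym : symmetric adj;
  adj_irrefl : irreflexive adj }.

Definition edges (G : sgraph) : {set {set G}} :=
  [set e : {set G} | [exists u : G, exists v : G,
     adj u v && (e == [set u; v]%SET)]]%SET.

Definition isomorphic (G H : sgraph) : Prop :=
  exists f : G -> H, bijective f /\ forall x y, adj (f x) (f y) = adj x y.

Definition adj_minus (G : sgraph) (X : {set G}) : rel G :=
  [rel x y | [&& x \notin X, y \notin X & adj x y]].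

Definition components_minus (G : sgraph) (X : {set G}) : nat :=
  n_comp (adj_minus X) (~: X)%SET.

Definition separating (G : sgraph) (X : {set G}) : bool :=
  (1 < components_minus X)%N.

(* A graph without separating sets, i.e. a complete graph, gets +oo. *)
Definition toughness (R : realType) (G : sgraph) : \bar R :=
  \big[Order.min/+oo%E]_(X : {set G} | separating X)
    (#|X|%:R / (components_minus X)%:R)%:E.

Definition tough (R : realType) (t : R) (G : sgraph) : Prop :=
  (t%:E <= toughness R G)%E.

(* A chord joins two vertices of the cycle that are not consecutive on it. *)
Definition chordal (G : sgraph) : Prop :=
  forall s : seq G, ucycle (@adj G) s -> (3 < size s)%N ->
  exists x y : G,
    [/\ x \in s, y \in s, adj x y, next s x != y & next s y != x].

Definition arc_between (R : realType) (A : set (R * R)) (a b : R * R) : Prop :=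
  exists f : R -> R * R,
    [/\ {within `[0, 1], continuous f}, {in `[0, 1] &, injective f},
        f 0 = a, f 1 = b & A = f @` `[0, 1]].

(* [pos] places the vertices and [arc e] is the curve representing the edge
   [e]; [edge_interior] is that curve without its two endpoints. *)
Definition edge_interior (R : realType) (G : sgraph) (pos : G -> R * R)
    (arc : {set G} -> set (R * R)) (e : {set G}) : set (R * R) :=
  arc e `\` [set pos x | x in [set` e]].

Definition plane_drawing (R : realType) (G : sgraph) (pos : G -> R * R)
    (arc : {set G} -> set (R * R)) : Prop :=
  [/\ injective pos,
      forall u v : G, adj u v ->
        arc_between (arc [set u; v]%SET) (pos u) (pos v),
      forall e, e \in edges G -> forall w : G, ~ edge_interior pos arc e (pos w)
    & forall e e', e \in edges G -> e' \in edges G -> e != e' ->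
        edge_interior pos arc e `&` arc e' = set0].

Definition planar (R : realType) (G : sgraph) : Prop :=
  exists (pos : G -> R * R) (arc : {set G} -> set (R * R)),
    plane_drawing pos arc.

(* Number of vertices of a longest cycle; cycles have at least 3 vertices, and
   the value is 0 for a graph without cycles. *)
Definition circumference (G : sgraph) : nat :=
  \max_(k < #|G|.+1 | (2 < k)%N &&
     [exists s : k.-tuple G, cycle (@adj G) s && uniq s]) k.

(* [ln 0 = 0] and division by 0 give the value 0 when [G] has no cycle or at
   most one vertex, where the logarithm is meaningless.  Among 1-tough graphs
   this concerns only those with at most 2 vertices, hence finitely many terms
   of a sequence of pairwise non-isomorphic graphs. *)
Definition log_circumference (R : realType) (G : sgraph) : R :=
  ln (circumference G)%:R / ln #|G|%:R.

Definition shortness_exponent (R : realType) (Gamma : sgraph -> Prop) :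
    \bar R :=
  ereal_inf [set l : \bar R | exists G : nat -> sgraph,
    [/\ forall n, Gamma (G n),
        forall m n, m <> n -> ~ isomorphic (G m) (G n)
      & l = limn_einf (fun n => (log_circumference R (G n))%:E)]].

(* Main.v *)
Require Import Defs.
From mathcomp Require Import all_boot all_order all_algebra.
From mathcomp Require Import all_classical all_reals all_analysis.
From mathcomp Require Import zify lra ring.
Import Order.TTheory GRing.Theory Num.Theory numFieldNormedType.Exports.

(** The logarithms in question are never negative, so it is enough to exhibit
one sequence of 1-tough chordal planar graphs along which they tend to 0, that
is, graphs whose longest cycles are polylogarithmic in the number of vertices.

Take the infinite binary tree on 1, 2, 3, ..., where x has the children 2x and
2x+1, and make each triple x, 2x, 2x+1 a triangle.  The vertices up to m form a
tree of triangles in which every vertex lies in at most two triangles.  Join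
all of them to one further vertex 0, the apex; as 1 / 2 = 0 in integer
division, the apex is also the parent of 1.

- Chordality.  The neighbours of z smaller than z are among 0, z / 2 and the
  sibling z - 1, which are pairwise adjacent.  Hence the two neighbours on a
  cycle of its largest vertex are joined by a chord ([elimination_chordal]).

- Toughness.  A separating set X contains the apex.  The parent of the least
  vertex of a component of G - X lies in X, for it is a smaller neighbour.  Two
  children of one vertex are adjacent, so different components yield different
  parents, and X has at least as many elements as G - X has components
  ([heap_graph_components]).

- Short cycles.  Without the apex, the proper descendants of x can only be left
  through x.  A path from p to q that visits y cannot go through the parent of y
  both before and after y, so that parent is a proper ancestor of p or of q
  ([parent_above_path_end]).  On n levels there are at most 2 * n such
  ancestors, and each has two children: a path avoiding the apex has at most
  4 * n vertices, a cycle at most 4 * n + 1.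

- Planarity.  In preorder, the subtree of x is an interval that starts with x
  and splits into the intervals of the subtrees of 2x and 2x+1.  Therefore no
  two edges of the tree of triangles cross when the vertices are put on a line
  in preorder and the edges are drawn on one side of it
  ([preorder_noncrossing]).  The other side is free for the segments to the
  apex ([one_page_plane_drawing]).

With m = 2 ^ 4 ^ k the tree has 4 ^ k + 1 levels, so the logarithm of the
circumference to the base of the order is O(k / 4 ^ k). *)

(** * A binary tree of triangles with an apex *)

(** The layout of a binary heap, in which [x %/ 2] is the parent of [x]. *)
Definition heap_adj (x y : nat) : bool :=
  (x != y) && [|| x == 0, y == 0, x %/ 2 == y, y %/ 2 == x | x %/ 2 == y %/ 2].

Lemma heap_adj_sym : symmetric heap_adj.
Proof. by move=> x y; rewrite /heap_adj; lia. Qed.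

Lemma heap_adj_irrefl : irreflexive heap_adj.
Proof. by move=> x; rewrite /heap_adj eqxx. Qed.

Definition heap_graph (m : nat) : sgraph :=
  @SGraph 'I_m.+1 (fun x y => heap_adj x y)
    (fun x y => heap_adj_sym x y) (fun x => heap_adj_irrefl x).

(** * Chordality *)

(** The hypothesis says that increasing [rank] is the reverse of a perfect
elimination order.  The vertex of largest rank on a cycle has two neighbours on
it, both of smaller rank and hence adjacent; they are not consecutive on a cycle
with more than three vertices. *)
Lemma elimination_chordal (G : sgraph) (rank : G -> nat) :
    injective rank ->
    (forall x y z : G, rank x < rank z -> rank y < rank z -> x != y ->
      adj z x -> adj z y -> adj x y) ->
  chordal G.
Proof.
move=> rank_inj elim s /andP[cyc_s uniq_s] s4.
have s_gt0 : 0 < size s by apply: leq_trans s4.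
case: s s4 s_gt0 cyc_s uniq_s => // x0 s1 s4 _ cyc_s uniq_s.
have x0s : x0 \in x0 :: s1 by rewrite mem_head.
case: (arg_maxnP rank x0s) => z zs zmax.
have [i t Ht] := rot_to zs.
have cyc_t : cycle (@adj G) (z :: t) by rewrite -Ht rot_cycle.
have uniq_t : uniq (z :: t) by rewrite -Ht rot_uniq.
have size_t : 3 < size (z :: t) by rewrite -Ht size_rot.
have mem_t v : (v \in x0 :: s1) = (v \in z :: t) by rewrite -Ht mem_rot.
have next_t v : next (x0 :: s1) v = next (z :: t) v.
  by rewrite -Ht next_rot.
case: t {Ht} cyc_t uniq_t size_t mem_t next_t => // y [//|u t].
case/lastP: t => [//|t x] cyc_t uniq_t _ mem_t next_t.
have adj_zy : adj z y by case/andP: cyc_t.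
have adj_xz : adj x z.
  by move: cyc_t; rewrite /= rcons_path last_rcons => /andP[_ /andP[_ /andP[]]].
have ys : y \in x0 :: s1 by rewrite mem_t !inE eqxx orbT.
have xs : x \in x0 :: s1 by rewrite mem_t !inE mem_rcons mem_head !orbT.
have [yz zx ux xy] : [/\ y != z, x != z, u != x & x != y].
  move: uniq_t; rewrite /= !inE !mem_rcons !inE !negb_or.
  move=> /and4P[/and4P[zy _ zx _] /and3P[_ yx _] /andP[ux _] _].
  by split; rewrite // eq_sym.
have lower v : v \in x0 :: s1 -> v != z -> rank v < rank z.
  move=> vs vz; rewrite ltn_neqAle (inj_eq rank_inj) vz.
  exact: zmax.
(* [x] is last on the rotated cycle, so that the first vertex [z] follows it. *)
exists x, y; split=> //.
- by apply: (elim _ _ z) => //; rewrite ?lower // adj_sym.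
- rewrite next_t.
  rewrite -(next_rotr 1 uniq_t) -[[:: z, y, u & _]]/(rcons [:: z, y, u & t] x).
  by rewrite rotr1_rcons /= eqxx /= eq_sym.
- by rewrite next_t /= (negbTE yz) eqxx.
Qed.

(** The neighbours below [z] are among [0], the parent of [z] and, for odd [z],
its sibling [z.-1]. *)
Lemma heap_adj_lower_clique x y z :
  x < z -> y < z -> x != y -> heap_adj z x -> heap_adj z y -> heap_adj x y.
Proof. rewrite /heap_adj; lia. Qed.

Lemma heap_graph_chordal m : chordal (heap_graph m).
Proof.
apply: (@elimination_chordal (heap_graph m) (@nat_of_ord m.+1)); first exact: ord_inj.
by move=> x y z xz yz xy zx zy; apply: heap_adj_lower_clique zx zy.
Qed.

(** * Toughness *)

(** Each component is charged to the parent of its least vertex.  This parent is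
a smaller neighbour of that vertex, so it has been deleted; and it is charged
once only, since siblings are adjacent. *)
Lemma heap_graph_components m (X : {set heap_graph m}) :
  separating X -> components_minus X <= #|X|.
Proof.
rewrite /separating /components_minus /n_comp_mem.
set e := adj_minus X; set C := (X in #|X|) => sepX.
have adjE (x y : heap_graph m) : e x y = [&& x \notin X, y \notin X & heap_adj x y].
  by [].
have e_sym : connect_sym e.
  by apply: sym_connect_sym; move=> x y; rewrite !adjE andbCA heap_adj_sym.
(* If the apex is kept, it is adjacent to all other remaining vertices. *)
have X0 : (ord0 : heap_graph m) \in X.
  apply: contraLR sepX => X0; rewrite -leqNgt.
  rewrite -(card1 (fingraph.root e (ord0 : heap_graph m))); apply: subset_leq_card.
  apply/fintype.subsetP => r; rewrite !inE => /andP[/eqP rr rX].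
  rewrite -rr; apply/eqP/(fingraph.rootP e_sym).
  have [->//|r0] := eqVneq r ord0.
  by apply: connect1; rewrite adjE rX X0 /heap_adj r0 orbT.
pose low (r : heap_graph m) : heap_graph m := [arg min_(y < r | connect e r y) y].
have lowP r : connect e r (low r) /\
    forall y : heap_graph m, connect e r y -> low r <= y.
  by rewrite /low; case: arg_minnP => //; apply: connect0.
have lowX r : r \notin X -> low r \notin X.
  move=> rX; have [+ _] := lowP r.
  have cl : fingraph.closed e [predC X].
    by move=> x y; rewrite adjE !inE => /and3P[xX yX _]; rewrite xX yX.
  by move=> /(closed_connect cl); rewrite !inE rX => <-.
pose up r : heap_graph m := inord (low r %/ 2).
have upE r : up r = low r %/ 2 :> nat.
  by rewrite inordK // (leq_ltn_trans (leq_div _ _)).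
have low0 r : r \notin X -> (low r : nat) != 0.
  move=> /lowX; apply: contra => /eqP lr0.
  by rewrite (_ : low r = ord0) //; apply: ord_inj.
have upX r : r \notin X -> up r \in X.
  move=> rX; apply: contraT => uX; have [rl lmin] := lowP r.
  have : connect e r (up r).
    apply: connect_trans rl (connect1 _).
    rewrite adjE lowX // uX /heap_adj upE; move: (low0 r rX); lia.
  by move=> /lmin; rewrite upE; move: (low0 r rX); lia.
have up_inj : {in C &, injective up}.
  move=> r r'; rewrite !inE => /andP[/eqP rr rX] /andP[/eqP rr' rX'] eq_up.
  rewrite -rr -rr'; apply/(fingraph.rootP e_sym).
  have [rl _] := lowP r; have [rl' _] := lowP r'.
  apply: connect_trans rl _; rewrite e_sym; apply: connect_trans rl' _.
  have [->//|neq] := eqVneq (low r') (low r).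
  apply: connect1; rewrite adjE !lowX // /heap_adj.
  by rewrite (inj_eq (@ord_inj _)) neq -!upE eq_up eqxx !orbT.
rewrite -(@card_in_image _ _ up C up_inj); apply: subset_leq_card.
apply/fintype.subsetP => _ /fintype.imageP[r + ->]; rewrite !inE => /andP[_ rX].
exact: upX.
Qed.

Lemma tough1_of_components (R : realType) (G : sgraph) :
    (forall X : {set G}, separating X -> components_minus X <= #|X|) ->
  tough (1%R : R) G.
Proof.
move=> compX; apply: le_bigmin => [|X sepX]; first exact: leey.
have pos : (0 < (components_minus X)%:R :> R)%R.
  by rewrite ltr0n; apply: leq_trans sepX.
by rewrite lee_fin ler_pdivlMr // mul1r ler_nat compX.
Qed.

(** * Longest cycles *)

(** Proper descendants.  All numbers are proper descendants of [0], even [0]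
itself, because large powers of 2 give the quotient 0. *)
Definition strictly_below (x y : nat) : Prop := exists2 i, 0 < i & y %/ 2 ^ i = x.

(** The children and the sibling of a proper descendant of [x] are again proper
descendants of [x], and so is its parent unless it is [x]. *)
Lemma heap_adj_exit x y z : z != 0 -> heap_adj y z -> strictly_below x y ->
  z = x \/ strictly_below x z.
Proof.
move=> z0 yz [[//|i] _]; rewrite expnS divnMA => yx.
have y0 : y != 0 \/ x = 0.
  by case: (posnP y) yx => [-> <-|]; [right; rewrite !div0n | left; lia].
case: y0 => [y0|x0]; last first.
  right; exists z.+1 => //; rewrite x0 divn_small //.
  by apply: ltn_trans (ltn_expl _ _).
have /or3P[] : [|| y %/ 2 == z, z %/ 2 == y | y %/ 2 == z %/ 2].
- by move: yz; rewrite /heap_adj (negbTE y0) (negbTE z0) => /andP[].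
- move=> /eqP yz2; rewrite yz2 in yx.
  by case: i yx => [|i] yx; [left; rewrite -yx divn1 | right; exists i.+1].
- move=> /eqP zy; right; exists i.+2 => //.
  by rewrite expnS divnMA zy expnS divnMA.
- move=> /eqP zy; right; exists i.+1 => //.
  by rewrite expnS divnMA -zy.
Qed.

Lemma path_exit x y s : path heap_adj y s -> 0 \notin s -> strictly_below x y ->
  x \in s \/ strictly_below x (last y s).
Proof.
elim: s y => [|z s IHs] y /=; first by right.
rewrite inE negb_or eq_sym => /andP[yz zs] /andP[z0 s0] xy.
case: (heap_adj_exit x y z z0 yz xy) => [->|xz]; first by left; rewrite mem_head.
by case: (IHs z zs s0 xz) => [xs|]; [left; rewrite inE xs orbT | right].
Qed.

(** Otherwise the path would have to leave the proper descendants of the parent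
of [y] on both sides of [y], each time through this parent, which is thus
repeated. *)
Lemma parent_above_path_end p s y :
    path heap_adj p s -> uniq (p :: s) -> 0 \notin p :: s -> y \in p :: s ->
  strictly_below (y %/ 2) p \/ strictly_below (y %/ 2) (last p s).
Proof.
move=> ps us s0 ys.
have yy : strictly_below (y %/ 2) y by exists 1.
move: ps us s0; case/splitPl: ys => s1 s2 ylast.
rewrite cat_path last_cat ylast -cat_cons cat_uniq mem_cat negb_or.
move=> /andP[ps1 ps2] /and3P[_ s12 _] /andP[s10 s20].
case: (path_exit _ _ _ ps2 s20 yy) => [ys2|]; last by right.
have ps1r : path heap_adj y (rev (belast p s1)).
  rewrite -ylast rev_path; apply: sub_path ps1 => u v; by rewrite heap_adj_sym.
have s1r : {subset rev (belast p s1) <= p :: s1}.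
  by move=> u; rewrite mem_rev => /mem_belast.
have [||] := path_exit _ _ _ ps1r _ yy.
- by apply: contra s10 => /s1r.
- by move=> /s1r ys1; case/hasP: s12; exists (y %/ 2).
- case: (s1) ylast => [|z s1'] /=; first by move=> -> ?; left.
  by rewrite rev_cons last_rcons => _ ?; left.
Qed.

(** The children of the proper ancestors of [p], for [p] on one of the first [n]
levels of the tree. *)
Definition ancestor_children (n p : nat) : seq nat :=
  [seq 2 * (p %/ 2 ^ i) + b | i <- iota 1 n, b <- [:: 0; 1]].

Lemma size_ancestor_children n p : size (ancestor_children n p) = 2 * n.
Proof. by rewrite size_allpairs size_iota mulnC. Qed.

Lemma mem_ancestor_children n p y : 0 < n -> p < 2 ^ n ->
  strictly_below (y %/ 2) p -> y \in ancestor_children n p.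
Proof.
move=> n0 pn [i i0 piy].
(* The quotients of [p] are 0 from the exponent [n] on. *)
have py : p %/ 2 ^ minn i n = y %/ 2.
  have [//|ni] := leqP i n; rewrite -piy !divn_small //.
  by apply: leq_trans pn _; rewrite leq_exp2l // ltnW.
apply/allpairsP; exists (minn i n, y %% 2) => /=; rewrite py; split.
- by rewrite mem_iota; lia.
- by rewrite !inE; lia.
- by lia.
Qed.

Lemma size_heap_path n p s : 0 < n ->
    path heap_adj p s -> uniq (p :: s) -> 0 \notin p :: s ->
    all (fun y => y < 2 ^ n) (p :: s) ->
  size (p :: s) <= 4 * n.
Proof.
move=> n0 ps us s0 sn.
have -> : 4 * n = size (ancestor_children n p ++ ancestor_children n (last p s)).
  by rewrite size_cat !size_ancestor_children; lia.
apply: uniq_leq_size => // y ys; rewrite mem_cat.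
have [yp|yq] := parent_above_path_end _ _ _ ps us s0 ys.
  by rewrite mem_ancestor_children // (allP sn) // mem_head.
by rewrite (mem_ancestor_children n (last p s)) ?orbT // (allP sn) // mem_last.
Qed.

Lemma size_heap_cycle n s : 0 < n ->
    cycle heap_adj s -> uniq s -> all (fun y => y < 2 ^ n) s ->
  size s <= (4 * n).+1.
Proof.
move=> n0.
have path_part t : path heap_adj (head 0 t) (behead t) -> uniq t ->
    0 \notin t -> all (fun y => y < 2 ^ n) t -> size t <= 4 * n.
  by case: t => // p t *; apply: size_heap_path.
move=> cs us sn; have [s0|s0] := boolP (0 \in s); last first.
  apply/leqW/path_part => //; case: s cs {us sn s0} => //= p s.
  by rewrite rcons_path => /andP[].
(* Rotated to start at the apex, the cycle continues with a path avoiding it. *)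
have [i t st] := rot_to s0.
rewrite -(size_rot i) st /= ltnS.
have /= /andP[_ tn] : all (fun y => y < 2 ^ n) (0 :: t).
  by rewrite -st; apply/allP => y; rewrite mem_rot => /(allP sn).
move: cs us; rewrite -(rot_cycle i) -(rot_uniq i) st /=.
rewrite rcons_path => /andP[ct _] /andP[t0 ut].
by apply: path_part => //; case: (t) ct => //= p t' /andP[].
Qed.

Lemma circumference_heap_graph m n : 0 < n -> m < 2 ^ n ->
  circumference (heap_graph m) <= (4 * n).+1.
Proof.
move=> n0 mn; apply/bigmax_leqP => k /andP[_ /existsP[s /andP[cs us]]].
rewrite -(size_tuple s) -(size_map (@nat_of_ord m.+1)).
apply: size_heap_cycle => //.
- by case: s cs {us} => [[|x s] //= _]; rewrite -map_rcons path_map.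
- by rewrite map_inj_uniq //; apply: ord_inj.
- by apply/allP => _ /mapP[x _ ->]; apply: leq_trans mn; apply: ltn_ord.
Qed.

(** * Preorder positions *)

Definition below (x y : nat) : Prop := exists i, y %/ 2 ^ i = x.

Lemma below_refl x : below x x.
Proof. by exists 0; rewrite divn1. Qed.

Lemma below_half x y : below x (y %/ 2) -> below x y.
Proof. by move=> [i <-]; exists i.+1; rewrite expnS divnMA. Qed.

Lemma below_le x y : below x y -> x <= y.
Proof. by move=> [i <-]; apply: leq_div. Qed.

Lemma below_trans x y z : below x y -> below y z -> below x z.
Proof. by move=> [i <-] [j <-]; exists (j + i); rewrite expnD divnMA. Qed.

(** The number [p] of the third case is the last common ancestor.  The proof passes
from the larger number [y] to its parent, which may then be the smaller of the
two; as descendants are not smaller than their ancestors, [y] is never an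
ancestor of [x]. *)
Lemma heap_trichotomy x y : 0 < x -> x < y ->
  [\/ below (2 * x) y, below (2 * x).+1 y |
    exists2 p, 0 < p & below (2 * p) x /\ below (2 * p).+1 y \/
                       below (2 * p).+1 x /\ below (2 * p) y].
Proof.
elim/ltn_ind: y x => y IHy x x0 xy.
have up z : below z (y %/ 2) -> below z y by apply: below_half.
have y2y : y %/ 2 < y by lia.
have [xy2|y2x|xy2] := ltngtP x (y %/ 2).
- case: (IHy _ y2y x x0 xy2) => [/up|/up|[p p0 sib]].
  + by constructor 1.
  + by constructor 2.
  by constructor 3; exists p => //; case: sib => -[? /up ?]; [left|right].
- have y20 : 0 < y %/ 2 by lia.
  have yx z : below z x -> y != z.
    by move=> /below_le; lia.
  have yhalf : y = 2 * (y %/ 2) \/ y = (2 * (y %/ 2)).+1 by lia.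
  constructor 3; case: (IHy _ xy _ y20 y2x) => [bx|bx|[p p0 sib]].
  + exists (y %/ 2) => //; left; split => //.
    case: yhalf => yE; first by move: (yx _ bx); rewrite -yE eqxx.
    by rewrite -yE; apply: below_refl.
  + exists (y %/ 2) => //; right; split => //.
    case: yhalf => yE; last by move: (yx _ bx); rewrite -yE eqxx.
    by rewrite -yE; apply: below_refl.
  by exists p => //; case: sib => -[/up ? ?]; [right|left].
- have [->|->] : y = 2 * x \/ y = (2 * x).+1 by lia.
  + by constructor 1; apply: below_refl.
  by constructor 2; apply: below_refl.
Qed.

Definition depth (x : nat) : nat := trunc_log 2 x.

(** The least descendant of [x] on level [n], if levels are counted from 0. *)
Definition leftmost (n x : nat) : nat := x * 2 ^ (n - depth x).

(** Preorder is the lexicographic order of the pairs ([leftmost], [depth]), and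
depths are at most [n]: [n.+1] serves as the base of a positional encoding. *)
Definition preorder_pos (n x : nat) : nat := leftmost n x * n.+1 + depth x.

Lemma depth_at_level x y i : 0 < x -> y %/ 2 ^ i = x -> depth y = depth x + i.
Proof.
move=> x0 yx; apply: trunc_log_eq => //.
have /andP[lo hi] := trunc_log_bounds (isT : 1 < 2) x0.
rewrite -/(depth x) in lo hi.
have i0 : 0 < 2 ^ i by rewrite expn_gt0.
rewrite -addSn !expnD -leq_divRL // -ltn_divLR // yx lo hi //.
Qed.

Lemma depth_le n x : 0 < x -> x < 2 ^ n.+1 -> depth x <= n.
Proof.
move=> x0 xn; rewrite -ltnS -(ltn_exp2l _ _ (isT : 1 < 2)).
by apply: leq_ltn_trans xn; apply: trunc_logP.
Qed.

Lemma depth_sibling p : 0 < p -> depth (2 * p).+1 = depth (2 * p).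
Proof.
move=> p0; rewrite (depth_at_level p (2 * p) 1) ?(depth_at_level p (2 * p).+1 1) //; lia.
Qed.

Lemma leftmost_subtree n x y : 0 < x -> depth y <= n -> below x y ->
  leftmost n x <= leftmost n y < x.+1 * 2 ^ (n - depth x).
Proof.
move=> x0 yn [i yx]; rewrite /leftmost.
have dy := depth_at_level _ _ _ x0 yx; rewrite dy in yn *.
have -> : n - depth x = i + (n - (depth x + i)) by lia.
set e := n - (depth x + i); have e0 : 0 < 2 ^ e by rewrite expn_gt0.
have i0 : 0 < 2 ^ i by rewrite expn_gt0.
rewrite expnD !mulnA leq_pmul2r // ltn_pmul2r //.
by rewrite -yx leq_divM //= ltn_ceil.
Qed.

Lemma preorder_pos_subtree n x y : 0 < x -> depth y <= n -> below x y ->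
  preorder_pos n x <= preorder_pos n y.
Proof.
move=> x0 yn xy; have /andP[lo _] := leftmost_subtree _ _ _ x0 yn xy.
have [i yx] := xy; have dy := depth_at_level _ _ _ x0 yx.
by apply: leq_add; rewrite ?leq_mul2r ?lo ?orbT // dy leq_addr.
Qed.

Lemma preorder_pos_siblings n p y z : 0 < p -> depth y <= n -> depth z <= n ->
  below (2 * p) y -> below (2 * p).+1 z -> preorder_pos n y < preorder_pos n z.
Proof.
move=> p0 yn zn py pz; have p20 : 0 < 2 * p by lia.
have /andP[_ hi] := leftmost_subtree _ _ _ p20 yn py.
have /andP[lo _] := leftmost_subtree _ _ _ (ltn0Sn _) zn pz.
have yz : leftmost n y < leftmost n z.
  by apply: leq_trans hi _; move: lo; rewrite {1}/leftmost depth_sibling.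
by rewrite /preorder_pos; nia.
Qed.

Lemma preorder_pos_inj n y z : depth y <= n -> depth z <= n ->
  preorder_pos n y = preorder_pos n z -> y = z.
Proof.
rewrite /preorder_pos => yn zn yz.
have dyz : depth y = depth z.
  have := congr1 (modn^~ n.+1) yz.
  by rewrite /= !modnMDl !modn_small.
have : leftmost n y = leftmost n z by rewrite dyz in yz; nia.
rewrite /leftmost dyz => /eqP; rewrite eqn_pmul2r ?expn_gt0 //.
by move=> /eqP.
Qed.

Definition triangle (x : nat) : seq nat := [:: x; 2 * x; (2 * x).+1].

Lemma below_triangle x y : y \in triangle x -> below x y.
Proof.
rewrite !inE => /or3P[] /eqP ->; first exact: below_refl.
  by exists 1; lia.
by exists 1; lia.
Qed.

Lemma heap_adj_triangle u v : u != 0 -> v != 0 -> heap_adj u v ->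
  exists x, [/\ 0 < x, u \in triangle x & v \in triangle x].
Proof.
move=> u0 v0 uv.
have /or3P[] : [|| u %/ 2 == v, v %/ 2 == u | u %/ 2 == v %/ 2].
- by move: uv; rewrite /heap_adj (negbTE u0) (negbTE v0) => /andP[].
- by move=> uv2; exists v; rewrite !inE; split; lia.
- by move=> uv2; exists u; rewrite !inE; split; lia.
- by move=> uv2; exists (u %/ 2); rewrite !inE; move: uv; rewrite /heap_adj; split; lia.
Qed.

(** [x] precedes the two intervals taken by the subtrees of its children, and each
child comes first in its own interval; so no point of the triangle of [x] has
points of one of these intervals on both sides. *)
Lemma triangle_not_between n x k c y z : 0 < x ->
    k \in [:: 2 * x; (2 * x).+1] -> c \in triangle x ->
    depth c <= n -> depth y <= n -> depth z <= n -> below k y -> below k z ->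
  ~ (preorder_pos n y < preorder_pos n c < preorder_pos n z).
Proof.
move=> x0 kx cx cn yn zn ky kz /andP[yc cz].
have below_absurd : 0 < c -> below c y -> False.
  by move=> c0 /(preorder_pos_subtree n _ _ c0 yn); rewrite leqNgt yc.
have x2x : below x k.
  by move: kx; rewrite !inE => /orP[] /eqP ->; exists 1; lia.
move: cx kx; rewrite !inE => /or3P[] /eqP cE.
- by move=> _; apply: below_absurd; rewrite cE //; apply: below_trans ky.
- move=> /orP[] /eqP kE; first by apply: below_absurd; rewrite cE -?kE //; lia.
  rewrite kE in ky; have bc : below (2 * x) c by rewrite cE; apply: below_refl.
  by have := preorder_pos_siblings n _ _ _ x0 cn yn bc ky; lia.
- move=> /orP[] /eqP kE; last by apply: below_absurd; rewrite cE -?kE //; lia.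
  rewrite kE in kz.
  have bc : below (2 * x).+1 c by rewrite cE; apply: below_refl.
  by have := preorder_pos_siblings n _ _ _ x0 zn cn kz bc; lia.
Qed.

(** Each edge lies in a triangle, and two different triangles are either nested,
one under a child of the other's top vertex, or in subtrees of two siblings.
In the nested case [triangle_not_between] excludes a crossing, in the other case
the two edges occupy disjoint intervals. *)
Lemma preorder_noncrossing n u v u' v' :
    all (fun x => (x != 0) && (depth x <= n)) [:: u; v; u'; v'] ->
    heap_adj u v -> heap_adj u' v' ->
  ~ [/\ preorder_pos n u < preorder_pos n u',
        preorder_pos n u' < preorder_pos n v
      & preorder_pos n v < preorder_pos n v'].
Proof.
move=> /and5P[/andP[u0 un] /andP[v0 vn] /andP[u'0 u'n] /andP[v'0 v'n] _].
move=> /(heap_adj_triangle _ _ u0 v0)[x [x0 ux vx]].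
move=> /(heap_adj_triangle _ _ u'0 v'0)[x' [x'0 u'x' v'x']].
move=> [uu' u'v vv'].
have bu := below_triangle _ _ ux; have bv := below_triangle _ _ vx.
have bu' := below_triangle _ _ u'x'; have bv' := below_triangle _ _ v'x'.
have inner k : k \in [:: 2 * x; (2 * x).+1] -> ~ below k x'.
  move=> kx kx'; apply: (triangle_not_between n x k v u' v') => //.
  - exact: below_trans bu'.
  - exact: below_trans bv'.
  - by rewrite u'v.
have outer k : k \in [:: 2 * x'; (2 * x').+1] -> ~ below k x.
  move=> kx' kx; apply: (triangle_not_between n x' k u' u v) => //.
  - exact: below_trans bu.
  - exact: below_trans bv.
  - by rewrite uu'.
have apart p : 0 < p -> below (2 * p) x -> below (2 * p).+1 x' -> False.
  move=> p0 px px'.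
  have := preorder_pos_siblings n p v u' p0 vn u'n (below_trans _ _ _ px bv)
    (below_trans _ _ _ px' bu').
  by rewrite ltnNge (ltnW u'v).
have apart' p : 0 < p -> below (2 * p) x' -> below (2 * p).+1 x -> False.
  move=> p0 px' px.
  have := preorder_pos_siblings n p v' u p0 v'n un (below_trans _ _ _ px' bv')
    (below_trans _ _ _ px bu).
  by rewrite ltnNge (ltnW (ltn_trans (ltn_trans uu' u'v) vv')).
have [xx'|x'x|xx'] := ltngtP x x'.
- case: (heap_trichotomy _ _ x0 xx') => [b|b|[p p0 [[b b']|[b b']]]].
  + by apply: inner b; rewrite mem_head.
  + by apply: inner b; rewrite !inE eqxx orbT.
  + exact: apart b b'.
  + exact: apart' b' b.
- case: (heap_trichotomy _ _ x'0 x'x) => [b|b|[p p0 [[b b']|[b b']]]].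
  + by apply: outer b; rewrite mem_head.
  + by apply: outer b; rewrite !inE eqxx orbT.
  + exact: apart' b b'.
  + exact: apart b' b.
- (* A triangle does not have four different points. *)
  have uniq4 : uniq [:: u; u'; v; v'].
    apply: (@map_uniq _ _ (preorder_pos n)).
    by apply: (sorted_uniq ltn_trans ltnn); rewrite /= uu' u'v vv'.
  have sub3 : {subset [:: u; u'; v; v'] <= triangle x}.
    rewrite -xx' in u'x' v'x'.
    by apply/allP; rewrite /= ux u'x' vx v'x'.
  by have := uniq_leq_size uniq4 sub3.
Qed.

(** * Plane drawings of an apex over a one-page book embedding *)

Local Open Scope classical_set_scope.
Local Open Scope ring_scope.

(** Two monic parabolas with roots [a, b] and [c, d] differ by
[(a - c) * (b - t) + (d - b) * (t - c)].  Inside the smaller of two nested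
intervals both summands are nonnegative, and they vanish only if their first
factors do. *)
Lemma nested_parabolas_meet (R : realFieldType) (a b c d t : R) :
  c <= a -> b <= d -> a < t < b ->
  (t - a) * (t - b) = (t - c) * (t - d) -> a = c /\ b = d.
Proof.
move=> ca bd /andP[at_ tb] eq_par.
have h1 : 0 <= (a - c) * (b - t) by apply: mulr_ge0; lra.
have h2 : 0 <= (d - b) * (t - c) by apply: mulr_ge0; lra.
have h : (a - c) * (b - t) + (d - b) * (t - c) = 0 by nra.
have [h1' h2'] : (a - c) * (b - t) = 0 /\ (d - b) * (t - c) = 0 by split; lra.
move/eqP: h1'; move/eqP: h2'; rewrite !mulf_eq0.
by split; lra.
Qed.

Lemma parabola_neg (R : realFieldType) (a b t : R) :
  a < t < b -> (t - a) * (t - b) < 0.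
Proof. by move=> /andP[at_ tb]; rewrite nmulr_llt0; lra. Qed.

Lemma convex_strict (R : realFieldType) (a b r : R) :
  a < b -> 0 < r < 1 -> a < (1 - r) * a + r * b < b.
Proof. by move=> ab /andP[r0 r1]; apply/andP; split; nra. Qed.

Lemma onem_itvoo (R : realFieldType) (r : R) : 0 < r < 1 -> 0 < 1 - r < 1.
Proof. by lra. Qed.

Lemma unit_interval_cases (R : realFieldType) (r : R) : 0 <= r <= 1 ->
  [\/ r = 0, r = 1 | 0 < r < 1].
Proof.
rewrite !le_eqVlt eq_sym => /andP[/orP[/eqP ->|r0] /orP[/eqP r1|r1]].
- by constructor 1.
- by constructor 1.
- by constructor 2.
- by constructor 3; rewrite r0.
Qed.

(** The vertices other than the apex are put on the horizontal axis at the
abscissas [pos], their edges are drawn as arcs of monic parabolas below the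
axis, and the apex is joined to them by segments above the axis.  Parabolas of
the same curvature are convenient as they make nested arcs disjoint without any
choice of heights. *)
Section Drawing.
Context (R : realType) (G : sgraph) (apex : G) (pos : G -> nat).

(** Any negative abscissa for the apex makes this function injective, so that the
first coordinate alone shows every curve to be injective. *)
Definition abscissa (u : G) : R := if u == apex then - 1 else (pos u)%:R.
Definition ordinate (u : G) : R := (u == apex)%:R.
Definition place (u : G) : R * R := (abscissa u, ordinate u).

(** The last two factors make this zero when [u] or [v] is the apex, which lets one
formula for [curve] cover both the segments and the parabolas: between two points
[a] and [b] of the axis, at [t = (1 - s) * a + s * b], it gives the height
[(t - a) * (t - b)]. *)
Definition bend (u v : G) : R :=
  (abscissa u - abscissa v) ^+ 2 * ((1 - ordinate u) * (1 - ordinate v)).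

Definition curve (u v : G) (s : R) : R * R :=
  ((1 - s) * abscissa u + s * abscissa v,
   (1 - s) * ordinate u + s * ordinate v - s * (1 - s) * bend u v).

(** Quantifying over the endpoints turns the oriented [curve] into a function of
the unordered edge; [curveC] shows that the orientation is immaterial. *)
Definition curve_arc (e : {set G}) : set (R * R) :=
  [set z | exists u v s,
     [/\ adj u v, e = [set u; v]%SET, 0 <= s <= 1 & z = curve u v s]].

Lemma curve0 u v : curve u v 0 = place u.
Proof. by rewrite /curve /place; congr pair; ring. Qed.

Lemma curve1 u v : curve u v 1 = place v.
Proof. by rewrite /curve /place; congr pair; ring. Qed.

Lemma curveC u v s : curve v u s = curve u v (1 - s).
Proof. by rewrite /curve /bend; congr pair; ring. Qed.

Lemma curve_continuous u v : continuous (curve u v).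
Proof.
move=> s.
have id1 : (1 - t) @[t --> s] --> 1 - s.
  by apply: cvgB; [exact: cvg_cst|exact: cvg_id].
have affine (a b : R) :
    ((1 - t) * a + t * b) @[t --> s] --> (1 - s) * a + s * b.
  apply: cvgD; first by apply: cvgM; [exact: id1|exact: cvg_cst].
  by apply: cvgM; [exact: cvg_id|exact: cvg_cst].
have second : ((1 - t) * ordinate u + t * ordinate v - t * (1 - t) * bend u v)
    @[t --> s] --> (curve u v s).2.
  apply: cvgB; first exact: affine.
  apply: cvgM; last exact: cvg_cst.
  by apply: cvgM; [exact: cvg_id|exact: id1].
exact: (cvg_pair (affine (abscissa u) (abscissa v)) second).
Qed.

Hypothesis pos_inj : forall u v, u != apex -> v != apex -> pos u = pos v -> u = v.

Lemma abscissa_inj : injective abscissa.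
Proof.
move=> u v; rewrite /abscissa.
have pos_ge0 w : 0 <= (pos w)%:R :> R by apply: ler0n.
have [->|u1] := eqVneq u apex; have [->|v1] := eqVneq v apex => //.
- by move=> h; move: (pos_ge0 v); rewrite -h oppr_ge0 ler10.
- by move=> h; move: (pos_ge0 u); rewrite h oppr_ge0 ler10.
by move=> /eqP; rewrite eqr_nat => /eqP; apply: pos_inj.
Qed.

Lemma curve_arcE u v : adj u v -> curve_arc [set u; v]%SET = curve u v @` `[0, 1].
Proof.
move=> uv; apply/seteqP; split => z.
  move=> [u' [v' [s [uv' e s01 ->]]]].
  have [[-> ->]|[-> ->]] : u' = u /\ v' = v \/ u' = v /\ v' = u.
    have neq a b : @adj G a b -> a != b.
      by apply: contraTneq => ->; rewrite adj_irrefl.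
    have := neq _ _ uv; have := neq _ _ uv'.
    have : u' \in [set u; v]%SET by rewrite e !inE eqxx.
    have : v' \in [set u; v]%SET by rewrite e !inE eqxx orbT.
    rewrite !inE => /orP[] /eqP -> /orP[] /eqP ->; rewrite ?eqxx //; auto.
  - by exists s => //=; rewrite in_itv.
  - by rewrite curveC; exists (1 - s) => //=; rewrite in_itv /=; lra.
move=> [s /=]; rewrite in_itv /= => s01 <-.
by exists u, v, s.
Qed.

Lemma curve_arc_between u v : adj u v ->
  arc_between (curve_arc [set u; v]%SET) (place u) (place v).
Proof.
move=> uv; exists (curve u v); rewrite curve0 curve1 curve_arcE //; split=> //.
  exact/continuous_subspaceT/curve_continuous.
move=> s s' _ _ [eq_x _].
have uv0 : abscissa v - abscissa u != 0.
  rewrite subr_eq0; apply/eqP => /abscissa_inj vu.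
  by rewrite vu adj_irrefl in uv.
by apply: (mulfI uv0); lra.
Qed.

(** Normal forms for the points strictly inside an edge: on a segment oriented away
from the apex, or on a parabola over an interval oriented from left to right.
They reduce the comparison of two edges to one case for each pair of kinds. *)
Lemma curve_inner_shape u v s : adj u v -> 0 < s < 1 ->
  (exists w r, [/\ w != apex, [set u; v]%SET = [set apex; w]%SET, 0 < r < 1
     & curve u v s = ((1 - r) * - 1 + r * (pos w)%:R, 1 - r)]) \/
  (exists a b t, [/\ [&& a != apex, b != apex & adj a b],
     [set u; v]%SET = [set a; b]%SET, (pos a)%:R < t < (pos b)%:R
     & curve u v s = (t, (t - (pos a)%:R) * (t - (pos b)%:R))]).
Proof.
have spoke w r : w != apex ->
    curve apex w r = ((1 - r) * - 1 + r * (pos w)%:R, 1 - r).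
  move=> w1; rewrite /curve /bend /ordinate /abscissa eqxx (negbTE w1).
  by congr pair; rewrite /=; ring.
have page a b r : a != apex -> b != apex -> (pos a < pos b)%N -> 0 < r < 1 ->
    exists2 t, (pos a)%:R < t < (pos b)%:R &
      curve a b r = (t, (t - (pos a)%:R) * (t - (pos b)%:R)).
  move=> a1 b1 ab r01; exists ((1 - r) * (pos a)%:R + r * (pos b)%:R).
    have : (pos a)%:R < (pos b)%:R :> R by rewrite ltr_nat.
    by move=> ?; apply: convex_strict.
  rewrite /curve /bend /ordinate /abscissa (negbTE a1) (negbTE b1).
  by congr pair; rewrite /=; ring.
move=> uv s01; have s01' : 0 < 1 - s < 1 by apply: onem_itvoo.
have neq_uv : u != v by apply: contraTneq uv => ->; rewrite adj_irrefl.
have [u1|u1] := eqVneq u apex.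
  have v1 : v != apex by rewrite -u1 eq_sym.
  by left; exists v, s; split; rewrite ?u1 ?spoke.
have [v1|v1] := eqVneq v apex.
  rewrite v1; left; exists u, (1 - s).
  by split; [exact: u1|exact: finset.setUC|exact: s01'|rewrite curveC spoke].
right; have [vu|uv'|/pos_inj] := ltngtP (pos v) (pos u).
- have [t tP ct] := page v u _ v1 u1 vu s01'.
  exists v, u, t; split; [|exact: finset.setUC|exact: tP|by rewrite curveC].
  by rewrite v1 u1 adj_sym.
- have [t tP ct] := page u v _ u1 v1 uv' s01.
  by exists u, v, t; split; [rewrite v1 u1| |exact: tP|exact: ct].
- by move=> /(_ v1 u1) vu; rewrite vu eqxx in neq_uv.
Qed.

Hypothesis pos_noncrossing : forall u v u' v',
  all (fun w => w != apex) [:: u; v; u'; v'] -> adj u v -> adj u' v' ->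
  ~ [/\ (pos u < pos u')%N, (pos u' < pos v)%N & (pos v < pos v')%N].

(** Vertices have height 0 or 1, inner points of segments lie strictly between
these heights, and those of parabolas lie below the axis. *)
Lemma curve_inner_not_place u v s w : adj u v -> 0 < s < 1 ->
  curve u v s <> place w.
Proof.
move=> uv s01; case: (curve_inner_shape _ _ _ uv s01) => [[x [r [_ _ r01 ->]]]|].
  move=> [_]; have /andP[r0 r1] := onem_itvoo _ _ r01; move: r0 r1 => + + yw.
  by rewrite yw /ordinate; case: (w == apex); rewrite ltxx.
move=> [a [b [t [_ _ tab ->]]]] [_ yw].
have := parabola_neg _ _ _ _ tab; rewrite yw /ordinate.
by case: (w == apex); rewrite ?ltr10 ?ltxx.
Qed.

(** A segment and a parabola are on different sides of the axis, and on a segment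
the height and the abscissa of an inner point determine the lower end.  Two
parabolas that meet at an inner point have overlapping intervals; as these do
not cross, one contains the other, and [nested_parabolas_meet] applies. *)
Lemma curve_inner_disjoint u v s u' v' s' :
    adj u v -> adj u' v' -> 0 < s < 1 -> 0 < s' < 1 ->
    curve u v s = curve u' v' s' ->
  [set u; v]%SET = [set u'; v']%SET.
Proof.
move=> uv uv' s01 s01'.
case: (curve_inner_shape _ _ _ uv s01) => [[w [r [w1 -> r01 ->]]]|];
  case: (curve_inner_shape _ _ _ uv' s01') => [[w' [r' [w1' -> r01' ->]]]|].
- move=> /= [xE yE]; have rr' : r = r' by apply: oppr_inj; apply: addrI yE.
  rewrite -rr' in xE; suff -> : w = w' by [].
  apply: pos_inj => //; apply/eqP; rewrite -(eqr_nat R); apply/eqP.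
  have r0 : r != 0 by case/andP: r01 => r0 _; rewrite gt_eqF.
  by apply: (mulfI r0); apply: addrI xE.
- move=> [a [b [t [_ _ tab ->]]]] [_ yE].
  by have /andP[+ _] := onem_itvoo _ _ r01; rewrite yE ltNge (ltW (parabola_neg _ _ _ _ tab)).
- move=> [a [b [t [_ _ tab ->]]]] [_ yE].
  by have /andP[+ _] := onem_itvoo _ _ r01'; rewrite -yE ltNge (ltW (parabola_neg _ _ _ _ tab)).
- move=> [c [d [t' [/and3P[c1 d1 cd] -> tcd ->]]]].
  move=> [a [b [t [/and3P[a1 b1 ab] -> tab ->]]]] [tE yE].
  rewrite -tE in tcd yE.
  have /andP[at_ tb] := tab; have /andP[ct td] := tcd.
  have cb : (pos c < pos b)%N by rewrite -(ltr_nat R); apply: lt_trans tb.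
  have ad : (pos a < pos d)%N by rewrite -(ltr_nat R); apply: lt_trans td.
  have ncr := pos_noncrossing a b c d.
  have ncr' := pos_noncrossing c d a b.
  rewrite /= a1 b1 c1 d1 /= in ncr ncr'.
  have [/andP[ca bd]|/andP[ac db]] :
      (pos c <= pos a)%N && (pos b <= pos d)%N \/
      (pos a <= pos c)%N && (pos d <= pos b)%N.
    have [ac|ca|ac] := ltngtP (pos a) (pos c).
    - by right; rewrite leqNgt; apply/negP => bd; apply: ncr.
    - by left; rewrite leqNgt; apply/negP => db; apply: ncr'.
    - by case: (leqP (pos b) (pos d)) => [|/ltnW]; [left|right].
  - have [/eqP + /eqP] := nested_parabolas_meet _ _ _ _ _ _
      (etrans (ler_nat R _ _) ca) (etrans (ler_nat R _ _) bd) tab yE.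
    by rewrite !eqr_nat => /eqP /pos_inj -> // /eqP /pos_inj ->.
  - have [/eqP + /eqP] := nested_parabolas_meet _ _ _ _ _ _
      (etrans (ler_nat R _ _) ac) (etrans (ler_nat R _ _) db) tcd (esym yE).
    by rewrite !eqr_nat => /eqP /pos_inj -> // /eqP /pos_inj ->.
Qed.

Lemma interior_open e z : edge_interior place curve_arc e z ->
  exists u v s, [/\ adj u v, e = [set u; v]%SET, 0 < s < 1 & curve u v s = z].
Proof.
move=> [[u [v [s [uv eE s01 ->]]]] not_end]; exists u, v, s; split=> //.
have [s0|s1|//] := unit_interval_cases _ _ s01.
- by case: not_end; exists u; rewrite ?s0 ?curve0 //= eE !inE eqxx.
- by case: not_end; exists v; rewrite ?s1 ?curve1 //= eE !inE eqxx orbT.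
Qed.

Lemma one_page_plane_drawing : plane_drawing place curve_arc.
Proof.
split.
- by move=> u v [/abscissa_inj].
- exact: curve_arc_between.
- move=> e _ w /interior_open[u [v [s [uv _ s01 zE]]]].
  exact: (curve_inner_not_place _ _ _ w uv s01).
- move=> e e' _ _ ee'; rewrite -subset0 => z [].
  move=> /interior_open[u [v [s [uv eE s01 zE]]]].
  move=> [u' [v' [s' [uv' e'E s'01 zE']]]].
  have [s'0|s'1|s'01'] := unit_interval_cases _ _ s'01.
  - by apply: (curve_inner_not_place _ _ _ u' uv s01); rewrite zE zE' s'0 curve0.
  - by apply: (curve_inner_not_place _ _ _ v' uv s01); rewrite zE zE' s'1 curve1.
  have := curve_inner_disjoint _ _ _ _ _ _ uv uv' s01 s'01'.
  by rewrite zE -zE' -eE -e'E => /(_ erefl) ee; rewrite ee eqxx in ee'.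
Qed.

End Drawing.

Lemma heap_graph_planar (R : realType) m : planar R (heap_graph m).
Proof.
(* The number of levels is much smaller, but [m] bounds every depth. *)
pose pos (u : heap_graph m) := preorder_pos m u.
have ord0E (u : heap_graph m) : (u != ord0) = ((u : nat) != 0%N) by [].
have pos_depth (u : heap_graph m) : u != ord0 -> (depth u <= m)%N.
  rewrite ord0E -lt0n => u0; apply: depth_le => //.
  by apply: leq_trans (ltn_ord u) _; apply: ltnW; apply: ltn_expl.
exists (place R (heap_graph m) ord0 pos), (curve_arc R (heap_graph m) ord0 pos).
apply: one_page_plane_drawing.
- move=> u v u0 v0 /preorder_pos_inj uv; apply: ord_inj.
  by apply: uv; apply: pos_depth.
- move=> u v u' v' /and5P[u0 v0 u'0 v'0 _].
  by apply: preorder_noncrossing; rewrite /= -!ord0E !pos_depth ?u0 ?v0 ?u'0 ?v'0.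
Qed.

(** * The shortness exponent *)

Lemma ln_nat_ge0 (R : realType) (n : nat) : 0 <= ln n%:R :> R.
Proof. by case: n => [|n]; [rewrite ln0|rewrite ln_ge0 // ler1n]. Qed.

Lemma ln_pow2 (R : realType) (n : nat) : ln (2 ^ n)%:R = n%:R * ln 2 :> R.
Proof. by rewrite natrX lnXn // mulr_natl. Qed.

Lemma log_circumference_ge0 (R : realType) G : 0 <= log_circumference R G.
Proof. by rewrite divr_ge0 ?ln_nat_ge0. Qed.

Lemma ln_nat_le (R : realType) (a b : nat) : (a <= b)%N -> ln a%:R <= ln b%:R :> R.
Proof.
case: a => [|a] ab; first by rewrite ln0 ?ln_nat_ge0.
by rewrite ler_ln ?posrE ?ltr0n ?ler_nat // (leq_trans _ ab).
Qed.

(** Up to the common factor [ln 2], the numerator is at most [2 * k + 4] and the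
denominator at least [4 ^ k]; then [k + 2 <= 2 * 2 ^ k]. *)
Lemma log_circumference_heap_graph (R : realType) (k : nat) :
  log_circumference R (heap_graph (2 ^ 4 ^ k)) <= 4 * 2^-1 ^+ k.
Proof.
have ln2_gt0 : 0 < ln 2 :> R by rewrite ln_gt0 // ltr1n.
have c_le : (circumference (heap_graph (2 ^ 4 ^ k)) <= 2 ^ (2 * k + 4))%N.
  apply: leq_trans (circumference_heap_graph _ (4 ^ k).+1 _ _) _ => //.
    by rewrite ltn_exp2l.
  have : (0 < 4 ^ k)%N by rewrite expn_gt0.
  by rewrite expnD expnM -[(2 ^ 2)%N]/4%N -[(2 ^ 4)%N]/16%N; lia.
rewrite /log_circumference card_ord.
have num : ln (circumference (heap_graph (2 ^ 4 ^ k)))%:R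
    <= (4 * 2 ^ k)%:R * ln 2 :> R.
  apply: le_trans (ln_nat_le _ _ _ c_le) _; rewrite ln_pow2 ler_pM2r // ler_nat.
  by have := ltn_expl k (isT : (1 < 2)%N); lia.
have den : (4 ^ k)%:R * ln 2 <= ln (2 ^ 4 ^ k).+1%:R :> R.
  by rewrite -ln_pow2; apply: ln_nat_le.
have k4 : (4 ^ k)%:R * ln 2 > 0 :> R by rewrite mulr_gt0 // ltr0n expn_gt0.
rewrite ler_pdivrMr; last exact: lt_le_trans k4 den.
apply: le_trans num _.
have -> : (4 * 2 ^ k)%:R * ln 2 = 4 * 2^-1 ^+ k * ((4 ^ k)%:R * ln 2) :> R.
  rewrite mulrA; congr (_ * _).
  have -> : (4 ^ k = 2 ^ k * 2 ^ k)%N by rewrite -expnMn.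
  rewrite !natrM natrX exprVn.
  by rewrite -!mulrA mulKf // expf_neq0.
by rewrite ler_wpM2l // mulr_ge0 // exprn_ge0.
Qed.

Lemma limn_einf_ge0 (R : realType) (u : nat -> \bar R) :
  (forall n, 0 <= u n)%E -> (0 <= limn_einf u)%E.
Proof.
move=> u_ge0; rewrite limn_einf_lim; apply: lime_ge; first exact: is_cvg_einfs.
by apply: nearW => n; apply: le_ereal_inf_tmp => _ [m _ <-].
Qed.

Theorem theorem6 (R : realType) :
  shortness_exponent R
    (fun G : sgraph => [/\ tough (1%R : R) G, chordal G & planar R G]) = 0%E.
Proof.
apply/eqP; rewrite eq_le; apply/andP; split; last first.
  apply: le_ereal_inf_tmp => _ [G [_ _ ->]]; apply: limn_einf_ge0 => n.
  by rewrite lee_fin log_circumference_ge0.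
apply: ereal_inf_lbound; exists (fun k => heap_graph (2 ^ 4 ^ k)); split.
- move=> k; split; [|exact: heap_graph_chordal|exact: heap_graph_planar].
  by apply: tough1_of_components => X; apply: heap_graph_components.
- move=> i j ij [f [/bij_eq_card + _]]; rewrite !card_ord => -[/eqP].
  by rewrite !eqn_exp2l // => /eqP.
apply/esym; apply: (fst (cvg_limn_einf_sup _)).
apply: cvg_EFin; first exact: nearW.
apply: (@squeeze_cvgr _ _ _ _ (fun=> 0) (fun k => 4 * 2^-1 ^+ k)).
- apply: nearW => k /=; rewrite log_circumference_ge0.
  exact: log_circumference_heap_graph.
- exact: cvg_cst.
- rewrite -[X in _ --> X](mulr0 4); apply: cvgM; first exact: cvg_cst.
  by apply: cvg_expr; rewrite ger0_norm // invf_lt1 // ltr1n.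
Qed.
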